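(* Let $N\ge 2$ and let $[0,1]^N$ be equipped with the Lebesgue measure. There exist a bounded Borel function $P\colon[0,1]^N\to[0,\infty)$ with $\int_{[0,1]^N} P\,dx=1$, whose marginals $\pi_1P,\dotsc,\pi_NP$ are all continuous on $[0,1]$, and $\varepsilon>0$ such that for every $\sigma>0$ there exist continuous functions $\rho_j\colon[0,1]\to[0,\infty)$ with $\int_0^1\rho_j\,dt=1$ and $\lVert\pi_jP-\rho_j\rVert_{L^\infty([0,1])}<\sigma$ for every $j=1,\dotsc,N$, but such that no Borel function $P'\colon[0,1]^N\to[0,\infty)$ with $\pi_jP'=\rho_j$ for all $j=1,\dotsc,N$ satisfies $\lVert P-P'\rVert_{L^\infty([0,1]^N)}<\varepsilon$.
   Context: For a non-negative Borel function $P$ on $[0,1]^N$, $\pi_jP$ denotes its $j$-th marginal, the function on $[0,1]$ obtained by integrating $P(x_1,\dotsc,x_N)$ with respect to the Lebesgue measure in all the variables except $x_j$. *)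

(* Defs.v *)
From HB Require Import structures.
From mathcomp Require Import all_boot all_order all_algebra.
From mathcomp Require Import all_classical all_reals all_analysis.

Set Implicit Arguments.
Unset Strict Implicit.
Unset Printing Implicit Defensive.

Import Order.TTheory GRing.Theory Num.Theory.
Import numFieldNormedType.Exports.

Local Open Scope classical_set_scope.
Local Open Scope ring_scope.
Local Open Scope ereal_scope.

(* Points of R^n are n-tuples, with the product sigma-algebra, which is the
   Borel sigma-algebra of R^n. *)
Notation Rn R n := (n.-tuple (measurableTypeR R)).

(* The library has no n-dimensional Lebesgue measure: below, it is the n-fold
   product of the one-dimensional one, R^n.+1 being identified with R * R^n by
   [cons_point], and R^0 carrying the Dirac mass at its only point. *)
Section lebesgue_n.
Variable R : realType.

Definition cons_point n (p : measurableTypeR R * Rn R n) : Rn R n.+1 :=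
  [tuple of p.1 :: p.2].

Lemma measurable_cons_point n :
  measurable_fun [set: measurableTypeR R * Rn R n] (@cons_point n).
Proof. exact: measurable_cons. Qed.

HB.instance Definition _ n :=
  isMeasurableFun.Build _ _ _ _ (@cons_point n) (@measurable_cons_point n).

Section step.
Variables (n : nat) (mu : {sigma_finite_measure set Rn R n -> \bar R}).

Definition lebesgue_step : set (Rn R n.+1) -> \bar R :=
  pushforward (@lebesgue_measure R \x mu) (@cons_point n).

Let step0 : lebesgue_step set0 = 0.
Proof. exact: measure0. Qed.

Let step_ge0 A : 0 <= lebesgue_step A.
Proof. exact: measure_ge0. Qed.

Let step_sigma_additive : semi_sigma_additive lebesgue_step.
Proof. exact: measure_semi_sigma_additive. Qed.

HB.instance Definition _ := isMeasure.Build _ _ _ lebesgue_step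
  step0 step_ge0 step_sigma_additive.

Lemma lebesgue_step_sigma_finite : sigma_finite setT lebesgue_step.
Proof.
have /sigma_finiteP[F [TF ndF Foo]] := sigma_finiteT (@lebesgue_measure R).
have /sigma_finiteP[G [TG ndG Goo]] := sigma_finiteT mu.
exists (fun k => (fun x : Rn R n.+1 => (thead x, [tuple of behead x])) @^-1`
                   (F k `*` G k)) => [|k].
  apply/seteqP; split=> // x _ /=.
  have [k _ Fk] : (\bigcup_k F k) (thead x) by rewrite -TF.
  have [l _ Gl] : (\bigcup_k G k) [tuple of behead x] by rewrite -TG.
  exists (maxn k l) => //=; split => /=.
    by move: Fk; apply/subsetPset/ndF/leq_maxl.
  by move: Gl; apply/subsetPset/ndG/leq_maxr.
have [mF Fk] := Foo k; have [mG Gk] := Goo k.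
have mFG : measurable (F k `*` G k) by exact: measurableX.
split.
  rewrite -[X in measurable X]setTI.
  suff mg : measurable_fun setT
      (fun x : Rn R n.+1 => (thead x, [tuple of behead x])) by exact: mg.
  apply/measurable_fun_pair => /=; last exact: measurable_behead.
  exact: measurable_tnth.
rewrite /lebesgue_step /pushforward.
rewrite (_ : _ @^-1` _ = F k `*` G k).
  by rewrite product_measure1E// lte_mul_pinfty// ge0_fin_numE.
apply/seteqP; split => -[a y] /=; rewrite /cons_point theadE /=;
  by rewrite (_ : [tuple of _] = y)//; exact/val_inj.
Qed.

HB.instance Definition _ := Measure_isSigmaFinite.Build _ _ _
  lebesgue_step lebesgue_step_sigma_finite.

End step.

Fixpoint lebesgue_n n : {sigma_finite_measure set Rn R n -> \bar R} :=
  if n is m.+1 then lebesgue_step (lebesgue_n m) else \d_[tuple].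

End lebesgue_n.

Definition cube (R : realType) n : set (Rn R n) :=
  [set x | forall i, tnth x i \in `[0%R, 1%R]].
Arguments cube R n : clear implicits.

Lemma measurable_cube (R : realType) n : measurable (cube R n).
Proof.
rewrite (_ : cube R n =
    \bigcap_(i in [set: 'I_n]) (@tnth n _ ^~ i) @^-1` `[0%R, 1%R]).
  apply: fin_bigcap_measurable => [|i _]; first exact: finite_finset.
  rewrite -[_ @^-1` _]setTI.
  by apply: (@measurable_tnth _ (measurableTypeR R) n i).
by apply/seteqP; split => x /= h i; [move=> _|]; exact: h.
Qed.
Arguments measurable_cube R n : clear implicits.

(* The point of R^N with j-th coordinate t, the others being listed, in order,
   by y. *)
Definition insert_coord (R : realType) N (j : 'I_N) (t : R) (y : Rn R N.-1) :
    Rn R N :=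
  [tuple oapp (tnth y) t (unlift j i) | i < N].

(* Extended-real valued: a marginal may take the value +oo. *)
Definition marginal (R : realType) N (j : 'I_N) (P : Rn R N -> R) (t : R) :
    \bar R :=
  \int[lebesgue_n R N.-1]_(y in cube R N.-1) (P (insert_coord j t y))%:E.

(* The L^oo norm over D; it does not depend on the values of f outside D. *)
Definition Loo_norm d (T : measurableType d) (R : realType)
    (mu : {measure set T -> \bar R}) (D : set T) (mD : measurable D)
    (f : T -> \bar R) : \bar R :=
  'N[mrestr mu mD]_+oo [f].

(* Main.v *)
Require Import Defs.
From HB Require Import structures.
From mathcomp Require Import all_boot all_order all_algebra.
From mathcomp Require Import all_classical all_reals all_analysis.
From mathcomp Require Import measurable_realfun ess_sup_inf.
From mathcomp Require Import ring lra.
Set Implicit Arguments.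
Unset Strict Implicit.
Unset Printing Implicit Defensive.

Import Order.TTheory GRing.Theory Num.Theory.
Import numFieldNormedType.Exports.

Local Open Scope classical_set_scope.
Local Open Scope ring_scope.

(* Let P = 2 on {x_1 <= x_0} and P = 0 elsewhere (coordinates numbered from 0).
   Its marginals are 2t, 2(1 - t) and 1. The first one tends to 0 at t = 0,
   although P takes the value 2 on a set of positive measure in every slab
   {x_0 <= r}. Replace that marginal by a nearby density vanishing on [0, r] and
   keep the others: any P' with the new marginals vanishes almost everywhere on
   the slab, hence is at L^oo distance at least 2 from P. *)

(** * Iterated integration over the cube, and affine integrands on intervals *)

Lemma cube_cons_point (R : realType) n (t : R) (y : Rn R n) :
  cube R n.+1 (cons_point (t, y)) <-> t \in `[0, 1] /\ cube R n y.
Proof.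
split=> [h|[ht hy] i].
  split; first exact: (h ord0).
  by move=> i; have := h (lift ord0 i); rewrite tnthS.
by case: (unliftP ord0 i) => [k|] ->; rewrite ?tnthS ?tnth0//=; exact: hy.
Qed.

(** Tonelli: the measure on the left is the pushforward of a product along [cons_point]. Extending
    [f] by zero lets the theorem be applied on the whole space, and the extension vanishes on every
    slice with [t] outside the unit interval. *)
Lemma integral_cubeS (R : realType) n (f : Rn R n.+1 -> \bar R) :
  measurable_fun (cube R n.+1) f -> (forall x, cube R n.+1 x -> 0 <= f x)%E ->
  (\int[lebesgue_n R n.+1]_(x in cube R n.+1) f x =
   \int[lebesgue_measure]_(t in `[0%R, 1%R])
     \int[lebesgue_n R n]_(y in cube R n) f (cons_point (t, y)))%E.
Proof.
move=> mf f0.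
rewrite integral_mkcond.
set g := f \_ _.
have mg : measurable_fun [set: Rn R n.+1] g.
  by apply/(measurable_restrictT _ (measurable_cube R n.+1)).
have g0 x : (0 <= g x)%E by apply: erestrict_ge0.
have mgc := measurableT_comp mg (@measurable_cons_point R n).
rewrite [LHS](ge0_integral_pushforward (@measurable_cons_point R n))//.
rewrite preimage_setT fubini_tonelli1//; last by move=> x /=.
rewrite [RHS]integral_mkcond; apply: eq_integral => t _.
rewrite /fubini_F /patch/=; case: ifPn => [/set_mem tin|tout].
  rewrite [RHS]integral_mkcond; apply: eq_integral => y _.
  rewrite /g /patch; congr (if _ then _ else _).
  apply/idP/idP => /set_mem h; apply/mem_set.
    by case/cube_cons_point: h.
  exact/cube_cons_point.
apply: integral0_eq => y _; rewrite /g /patch ifF//.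
apply/negP => /set_mem /cube_cons_point[] h _.
by move/negP: tout; apply; exact: mem_set.
Qed.

Lemma lebesgue_n_cube (R : realType) n : lebesgue_n R n (cube R n) = 1%E.
Proof.
elim: n => [|n IHn].
  by rewrite /= diracE mem_set// => -[].
have := @integral_cubeS R n (cst 1%E) (measurable_cst _) (fun _ _ => lee01).
rewrite integral_cst ?mul1e; last exact: measurable_cube.
move=> ->; under eq_integral => t _.
  rewrite (_ : integral _ _ _ = 1%E); first over.
  by rewrite integral_cst ?mul1e//; exact: measurable_cube.
rewrite integral_cst ?mul1e; last exact: measurable_itv.
by have := @lebesgue_measure_itv R `[0%R, 1%R]; rewrite /= lte01 oppr0 adde0.
Qed.

(** The other [n] coordinates contribute a factor 1, the volume of their cube. Once one of the first
    two coordinates of [stair] is fixed, its integrals have this form. *)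
Lemma integral_cube_head (R : realType) n (f : R -> \bar R) :
  measurable_fun setT f -> (forall t, 0 <= f t)%E ->
  (\int[lebesgue_n R n.+1]_(x in cube R n.+1) f (tnth x ord0) =
   \int[lebesgue_measure]_(t in `[0%R, 1%R]) f t)%E.
Proof.
move=> mf f0.
rewrite (@integral_cubeS R n (fun x => f (tnth x ord0)))//; last first.
  have mt := @measurable_tnth _ (measurableTypeR R) n.+1 ord0.
  exact: measurable_funTS (measurableT_comp mf mt).
apply: eq_integral => t _.
rewrite (_ : (fun y => _) = cst (f t)); last exact/funext.
rewrite integral_cst; last exact: measurable_cube.
by rewrite -[RHS]mule1; congr mule; exact: lebesgue_n_cube.
Qed.

Lemma integral_affine (R : realType) (p q a b : R) : a <= b ->
  (\int[lebesgue_measure]_(t in `[a, b]) (p * t + q)%:E =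
   (p / 2 * (b ^+ 2 - a ^+ 2) + q * (b - a))%:E)%E.
Proof.
(* The fundamental theorem of calculus, used below, needs [a < b]; a single point is a null set. *)
rewrite le_eqVlt => /predU1P[->|ab].
  by rewrite set_itv1 integral_set1 !subrr !mulr0 addr0.
pose F t : R := p / 2 * t ^+ 2 + q * t.
have dF (x : R) : is_derive x 1 F (p * x + q).
  rewrite /F; apply: is_derive_eq.
  by rewrite /GRing.scale/= !mulr1; field.
have cF : continuous F.
  by move=> x; apply/differentiable_continuous/derivable1_diffP.
rewrite (@continuous_FTC2 _ _ F)//.
- by rewrite -EFinB /F; congr EFin; ring.
- apply: continuous_subspaceT => x.
  by apply: cvgD; [apply: cvgM => //; exact: cvg_cst|exact: cvg_cst].
- split.
  + by move=> x _.
  + exact/cvg_at_right_filter/cF.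
  + exact/cvg_at_left_filter/cF.
- by move=> x _; rewrite derive1E derive_val.
Qed.

(** * Passing between the norm and pointwise or almost everywhere bounds *)

Lemma Loo_norm_le d (T : measurableType d) (R : realType)
    (mu : {measure set T -> \bar R}) (D : set T) (mD : measurable D)
    (f : T -> \bar R) (c : \bar R) : (0 <= c)%E ->
  (forall x, D x -> `|f x| <= c)%E -> (Loo_norm mu mD f <= c)%E.
Proof.
move=> c0 fc; rewrite /Loo_norm unlock; case: ifPn => // _.
apply/ess_supP; exists (~` D); split => /=; first exact: measurableC.
  by rewrite /mrestr setICl measure0.
by move=> x nfc Dx; apply: nfc; exact: fc.
Qed.

(** Positivity of [mu D] matters: for a zero measure the norm is 0 by convention, whatever [f]
    is. *)
Lemma Loo_norm_ae d (T : measurableType d) (R : realType)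
    (mu : {measure set T -> \bar R}) (D : set T) (mD : measurable D)
    (f : T -> \bar R) (c : \bar R) : (0 < mu D)%E ->
  (Loo_norm mu mD f <= c)%E -> \forall x \ae mu, D x -> (`|f x| <= c)%E.
Proof.
move=> D0; rewrite /Loo_norm unlock.
rewrite [X in if X then _ else _](_ : _ = true); last first.
  suff: (0 < mrestr mu mD setT)%E by [].
  by rewrite /mrestr setTI; exact: D0.
(* The restricted measure only says that [A] meets [D] in a null set, so the exceptional set for
   [mu] is the intersection. *)
move=> /ess_supP[A [mA A0 fA]]; exists (A `&` D); split => //.
  exact: measurableI.
move=> x /= /not_implyP[Dx nf]; split => //; exact: fA.
Qed.

(** * Integrals over the slabs where the first coordinate is at most [r] *)

Lemma measurable_head_le (R : realType) n (r : R) :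
  measurable [set x : Rn R n.+1 | tnth x ord0 <= r].
Proof.
rewrite (_ : mkset _ = (fun x : Rn R n.+1 => tnth x ord0) @^-1` `]-oo, r]).
  rewrite -[_ @^-1` _]setTI.
  exact: (@measurable_tnth _ (measurableTypeR R) n.+1 ord0).
by apply/seteqP; split=> x /=; rewrite in_itv.
Qed.

(** The cut concerns only the outer variable of the iterated integral, whose inner integral is the
    first marginal. *)
Lemma integral_cube_slab (R : realType) n (r : R) (f : Rn R n.+1 -> R) :
  r <= 1 -> measurable_fun (cube R n.+1) f ->
  (forall x, cube R n.+1 x -> 0 <= f x) ->
  (\int[lebesgue_n R n.+1]_(x in cube R n.+1 `&` [set x | (tnth x ord0 <= r)%R])
     (f x)%:E =
   \int[lebesgue_measure]_(t in `[0%R, r]) marginal ord0 f t)%E.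
Proof.
move=> r1 mf f0.
have mS := @measurable_head_le R n r.
rewrite [LHS]integral_mkcondr integral_cubeS; last 2 first.
- apply/(measurable_restrict _ mS (measurable_cube R n.+1)).
  apply: measurable_funS (measurable_cube R n.+1) _ _ => //.
  exact/measurable_EFinP.
- by move=> x cx; rewrite /patch; case: ifP => // _; rewrite lee_fin f0.
have -> : [set` `[0, r]] = [set` `[0, 1]] `&` [set` `]-oo, r]].
  apply/seteqP; split => t /=; rewrite !in_itv/=; lra.
rewrite [RHS]integral_mkcondr; apply: eq_integral => t _.
rewrite /patch (_ : (t \in [set` `]-oo, r]]) = (t <= r)); last first.
  by rewrite mem_setE in_itv.
case: ifPn => tr.
  apply: eq_integral => y _; rewrite mem_set /= ?tnth0//.
  (* Inserting [t] at position [ord0] is the same as consing it. *)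
  congr (f _)%:E; apply: eq_from_tnth => i; rewrite tnth_mktuple.
  by case: unliftP => [k|] ->; rewrite ?tnth0 ?tnthS.
apply: integral0_eq => y _; rewrite memNset//= tnth0/=.
exact/negP.
Qed.

(** * The density and its marginals *)

Definition stair (R : realType) n (x : Rn R n.+2) : R :=
  if tnth x (lift ord0 ord0) <= tnth x ord0 then 2 else 0.

Lemma stair_ge0 (R : realType) n (x : Rn R n.+2) : 0 <= stair x.
Proof. by rewrite /stair; case: ifP. Qed.

Lemma measurable_stair (R : realType) n : measurable_fun setT (@stair R n).
Proof.
apply: measurable_fun_ifT => //.
have mt i := @measurable_tnth _ (measurableTypeR R) n.+2 i.
exact: (measurable_fun_ler (mt _) (mt _)).
Qed.

Lemma integral_step_le (R : realType) (t : R) : t \in `[0, 1] ->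
  (\int[lebesgue_measure]_(s in `[0%R, 1%R]) (if s <= t then 2 else 0)%:E =
   (2 * t)%:E)%E.
Proof.
rewrite in_itv/= => t01.
transitivity (\int[@lebesgue_measure R]_(s in `[0%R, t]) (0 * s + 2)%:E)%E.
  have -> : [set` `[0, t]] = [set` `[0, 1]] `&` [set` `]-oo, t]].
    apply/seteqP; split => s /=; rewrite !in_itv/=; lra.
  rewrite [RHS]integral_mkcondr; apply: eq_integral => s _.
  by rewrite /patch mem_setE in_itv/=; case: ifP => // _; rewrite mul0r add0r.
rewrite integral_affine; last by lra.
by congr EFin; ring.
Qed.

Lemma integral_step_ge (R : realType) (t : R) : t \in `[0, 1] ->
  (\int[lebesgue_measure]_(s in `[0%R, 1%R]) (if t <= s then 2 else 0)%:E =
   (2 * (1 - t))%:E)%E.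
Proof.
rewrite in_itv/= => t01.
transitivity (\int[@lebesgue_measure R]_(s in `[t, 1%R]) (0 * s + 2)%:E)%E.
  have -> : [set` `[t, 1]] = [set` `[0, 1]] `&` [set` `[t, +oo[].
    apply/seteqP; split => s /=; rewrite !in_itv/=; lra.
  rewrite [RHS]integral_mkcondr; apply: eq_integral => s _.
  rewrite /patch mem_setE in_itv/= andbT.
  by case: ifP => // _; rewrite mul0r add0r.
rewrite integral_affine; last by lra.
by congr EFin; ring.
Qed.

Lemma integral_stair (R : realType) n :
  (\int[lebesgue_n R n.+2]_(x in cube R n.+2) (stair x)%:E = 1)%E.
Proof.
rewrite integral_cubeS; last 2 first.
- by apply/measurable_EFinP/measurable_funTS; exact: measurable_stair.
- by move=> x _; rewrite lee_fin stair_ge0.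
transitivity (\int[@lebesgue_measure R]_(t in `[0%R, 1%R]) (2 * t + 0)%:E)%E.
  apply: eq_integral => t /set_mem t01.
  rewrite addr0 -integral_step_le//.
  rewrite -(@integral_cube_head R n (fun s => (if s <= t then 2 else 0)%:E)).
  - by apply: eq_integral => y _; rewrite /stair tnthS tnth0.
  - apply/measurable_EFinP/measurable_fun_ifT => //.
    exact: measurable_fun_ler.
  - by move=> s; case: ifP.
by rewrite integral_affine//; congr EFin; field.
Qed.

(** Writes the three marginals 2t, 2(1 - t) and 1 as the single family 1 + s(2t - 1), so that
    continuity and total mass are checked once for all [j]. *)
Definition stair_slope (R : realType) n (j : 'I_n.+2) : R :=
  match val j with 0 => 1 | 1 => -1 | _ => 0 end.

Lemma marginal_stair (R : realType) n (j : 'I_n.+2) (t : R) : t \in `[0, 1] ->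
  marginal j (@stair R n) t = (1 + stair_slope R j * (2 * t - 1))%:E.
Proof.
move=> t01; rewrite /marginal /stair_slope.
case: (unliftP ord0 j) => [k|] ->; last first.
  transitivity (2 * t)%:E; last by rewrite /=; congr EFin; ring.
  rewrite -integral_step_le//.
  rewrite -(@integral_cube_head R n (fun s => (if s <= t then 2 else 0)%:E)).
  - by apply: eq_integral => y _; rewrite /stair !tnth_mktuple unlift_none liftK.
  - apply/measurable_EFinP/measurable_fun_ifT => //.
    exact: measurable_fun_ler.
  - by move=> s; case: ifP.
case: (unliftP ord0 k) => [i|] ->; last first.
  transitivity (2 * (1 - t))%:E; last by rewrite /=; congr EFin; ring.
  rewrite -integral_step_ge//.
  rewrite -(@integral_cube_head R n (fun s => (if t <= s then 2 else 0)%:E)).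
  - apply: eq_integral => y _; rewrite /stair !tnth_mktuple unlift_none/=.
    (* With coordinate 1 removed, coordinate 0 is still the first of those that remain. *)
    rewrite [X in unlift _ X](_ : _ = lift (lift ord0 ord0) ord0).
      by rewrite liftK.
    exact: val_inj.
  - apply/measurable_EFinP/measurable_fun_ifT => //.
    exact: measurable_fun_ler.
  - by move=> s; case: ifP.
(* An index of at least 2 exists only in dimension at least 3. Removing it leaves coordinates 0 and
   1 in place, so the marginal is the total mass of [stair] one dimension lower. *)
case: n i j k => [[]//|n] i _ _.
rewrite /= mul0r addr0 -(integral_stair R n).
apply: eq_integral => y _; rewrite /stair !tnth_mktuple.
rewrite [X in unlift _ X]
  (_ : _ = lift (lift ord0 (lift ord0 i)) (lift ord0 ord0)).
  rewrite [X in _ <= oapp _ _ (unlift _ X)]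
    (_ : _ = lift (lift ord0 (lift ord0 i)) ord0).
    by rewrite !liftK.
  exact: val_inj.
exact: val_inj.
Qed.

(** * The perturbed first marginal *)

(** The factor normalizes the ramp, since t - r has integral (1 - r)^2 / 2 over [r, 1]. *)
Lemma integral_ramp (R : realType) (r : R) : 0 <= r < 1 ->
  (\int[lebesgue_measure]_(t in `[0%R, 1%R])
     (2 / (1 - r) ^+ 2 * Num.max (t - r) 0)%:E = 1)%E.
Proof.
move=> /andP[r0 r1]; set k := 2 / _.
transitivity
  (\int[@lebesgue_measure R]_(t in `[r, 1%R]) (k * t + - (k * r))%:E)%E.
  have -> : [set` `[r, 1]] = [set` `[0, 1]] `&` [set` `[r, +oo[].
    apply/seteqP; split => s /=; rewrite !in_itv/=; lra.
  rewrite [RHS]integral_mkcondr; apply: eq_integral => s _.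
  rewrite /patch mem_setE in_itv/= andbT.
  case: ifPn => [rs|rs]; first by rewrite max_l ?subr_ge0// mulrBr.
  by rewrite max_r ?mulr0// subr_le0 ltW// ltNge.
rewrite integral_affine; last exact: ltW.
by congr EFin; rewrite /k; field; rewrite subr_eq0 gt_eqF.
Qed.

(** Up to r the difference is 2t. On [r, 1] it is affine, equal to 2r at r and to 2 - 2 / (1 - r) at
    1; the latter is at least -4r because r (1 - 2r) >= 0, which is where [r <= 1 / 2] enters. *)
Lemma ramp_close (R : realType) (r t : R) : 0 <= r <= 1 / 2 -> 0 <= t <= 1 ->
  `|2 * t - 2 / (1 - r) ^+ 2 * Num.max (t - r) 0| <= 4 * r.
Proof.
move=> r01 t01; rewrite ler_norml.
have u0 : 0 < 1 - r by lra.
have k_ge : 2 <= 2 / (1 - r) ^+ 2.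
  by rewrite ler_pdivlMr ?exprn_gt0//; nra.
have k_le : 2 / (1 - r) ^+ 2 * (1 - r) <= 2 + 4 * r.
  rewrite expr2 invfM -!mulrA mulVf ?gt_eqF// mulr1.
  by rewrite ler_pdivrMr//; nra.
move: k_ge k_le; set k := 2 / _ => k_ge k_le.
case: (leP (t - r) 0) => tr; first by rewrite mulr0; lra.
by apply/andP; split; nra.
Qed.

(** Integrals over the slab are compared: [stair] has mass r^2 there and [P'] has mass 0. The
    threshold 1, half the jump of [stair], suffices and turns the distance bound into a linear
    inequality. *)
Lemma stair_far (R : realType) n (r : R) (P' : Rn R n.+2 -> R) : 0 < r <= 1 ->
  measurable_fun (cube R n.+2) P' -> (forall x, cube R n.+2 x -> 0 <= P' x) ->
  (forall t, t \in `[0, r] -> marginal ord0 P' t = 0%E) ->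
  (1%:E < Loo_norm (lebesgue_n R n.+2) (measurable_cube R n.+2)
            (fun x => (stair x - P' x)%:E))%E.
Proof.
move=> /andP[r0 r1] mP' P'0 marg0; rewrite ltNge; apply/negP => /Loo_norm_ae.
rewrite [X in (0 < X)%E -> _]lebesgue_n_cube => /(_ lte01) PP'.
set mu := lebesgue_n R n.+2 in PP'.
set S := cube R n.+2 `&` [set x : Rn R n.+2 | tnth x ord0 <= r].
have mS : measurable S.
  by apply: measurableI; [exact: measurable_cube|exact: measurable_head_le].
have mP2 : measurable_fun S (EFin \o P').
  apply/measurable_EFinP; apply: measurable_funS (measurable_cube R n.+2) _ mP'.
  exact: subIsetl.
(* As stair takes only the values 0 and 2, |stair - P'| <= 1 and P' >= 0 give
   stair <= 2 P'. *)
have : (\int[mu]_(x in S) (stair x)%:E <=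
        \int[mu]_(x in S) (2%:E * (P' x)%:E))%E.
  apply: ae_ge0_le_integral => //.
  - by move=> x _; rewrite lee_fin stair_ge0.
  - by apply/measurable_EFinP/measurable_funTS; exact: measurable_stair.
  - by move=> x [cx _]; rewrite mule_ge0// lee_fin P'0.
  - exact: measurable_funeM.
  - apply: filterS PP' => x + [cx _] => /(_ cx).
    rewrite -EFinM /= !lee_fin ler_norml /stair.
    by have := P'0 x cx; case: ifP => _; lra.
rewrite ge0_integralZl//; last by move=> x [cx _]; rewrite lee_fin P'0.
rewrite !integral_cube_slab//; first last.
- by move=> x _; exact: stair_ge0.
- by apply: measurable_funTS; exact: measurable_stair.
rewrite [X in (_ <= _ * X)%E]integral0_eq ?mule0//.
apply/negP; rewrite -ltNge.
rewrite (@eq_integral _ _ _ _ _ (fun t : measurableTypeR R => (2 * t + 0)%:E)).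
  rewrite integral_affine ?(ltW r0)// lte_fin; nra.
move=> t; rewrite inE/= in_itv/= => t0r.
rewrite marginal_stair; last by rewrite in_itv/=; lra.
by rewrite /stair_slope/=; congr EFin; ring.
Qed.

(** * Choice of [r] and of the target densities for a given [sigma] *)

Theorem mainTheorem3 (R : realType) (N : nat) (hN : (2 <= N)%N) :
  exists (P : Rn R N -> R) (eps : R),
    [/\ measurable_fun (cube R N) P,
        (forall x, cube R N x -> 0 <= P x),
        (exists M : R, forall x, cube R N x -> P x <= M),
        (\int[lebesgue_n R N]_(x in cube R N) (P x)%:E = 1)%E &
        (forall j : 'I_N, {within `[0, 1], continuous (marginal j P)})] /\
    0 < eps /\
    forall sigma : R, 0 < sigma ->
      exists rho : 'I_N -> R -> R,
        (forall j : 'I_N,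
          [/\ {within `[0, 1], continuous (rho j)},
              (forall t, t \in `[0, 1] -> 0 <= rho j t),
              (\int[lebesgue_measure]_(t in `[0%R, 1%R]) (rho j t)%:E = 1)%E &
              (Loo_norm lebesgue_measure (measurable_itv `[0%R, 1%R])
                 (fun t => marginal j P t - (rho j t)%:E) < sigma%:E)%E]) /\
        ~ exists P' : Rn R N -> R,
          [/\ measurable_fun (cube R N) P',
              (forall x, cube R N x -> 0 <= P' x),
              (forall (j : 'I_N) (t : R), t \in `[0, 1] ->
                 marginal j P' t = (rho j t)%:E) &
              (Loo_norm (lebesgue_n R N) (measurable_cube R N)
                 (fun x => (P x - P' x)%:E) < eps%:E)%E].
Proof.
case: N hN => [//|[//|n]] _.
have cst_cvg (c t : R) : (fun=> c) x @[x --> t] --> c by exact: cvg_cst.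
have cm j : continuous (fun t : R => 1 + @stair_slope R n j * (2 * t - 1)).
  move=> t; apply: cvgD; first exact: cst_cvg.
  apply: cvgM; first exact: cst_cvg.
  by apply: cvgB; [apply: cvgM; [exact: cst_cvg|exact: cvg_id]|exact: cst_cvg].
exists (@stair R n), 1; split.
  split.
  - by apply: measurable_funTS; exact: measurable_stair.
  - by move=> x _; exact: stair_ge0.
  - by exists 2 => x _; rewrite /stair; case: ifP.
  - exact: integral_stair.
  - move=> j; pose m t : \bar R := (1 + @stair_slope R n j * (2 * t - 1))%:E.
    (* The affine formula for the marginal is known only on [0, 1], so continuity is transferred
       within that subspace. *)
    apply: (@subspace_eq_continuous _ _ _ m).
      by move=> t /set_mem t01; apply: esym; exact: (@marginal_stair R n j t t01).
    apply: continuous_subspaceT => t; apply: cvg_EFin; last exact: cm.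
    by near=> x.
split => // sigma sigma0.
(* The bound 1/2 is the one [ramp_close] requires; sigma / 8 makes its estimate 4r at most sigma /
   2. *)
pose r : R := Num.min (1 / 2) (sigma / 8).
have r01 : 0 < r <= 1 / 2.
  by rewrite /r lt_min ge_min lexx/= andbT; apply/andP; split; lra.
have rs : 4 * r < sigma.
  have : r <= sigma / 8 by rewrite /r ge_min lexx orbT.
  by lra.
pose rho (j : 'I_n.+2) (t : R) : R :=
  if j == ord0 then 2 / (1 - r) ^+ 2 * Num.max (t - r) 0
  else 1 + stair_slope R j * (2 * t - 1).
(* Nonexistence of [P'] comes first: the ramp vanishes on [0, r], so [stair_far] applies. *)
exists rho; split=> [j|[P' [mP' P'0 margP' /ltW]]]; last first.
  apply/negP; rewrite -ltNge; apply: (@stair_far _ _ r) => //; first by lra.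
  move=> t; rewrite in_itv/= => tr.
  rewrite margP'; last by rewrite in_itv/=; lra.
  by rewrite /rho eqxx max_r ?mulr0//; lra.
rewrite /rho; case: eqVneq => [->|j0]; split.
- apply: continuous_subspaceT => t; apply: cvgM; first exact: cst_cvg.
  apply: (@continuous_max R R (fun t => t - r) (fun=> 0)).
    by apply: cvgB; [exact: cvg_id|exact: cst_cvg].
  exact: cst_cvg.
- by move=> t _; rewrite mulr_ge0 ?divr_ge0 ?sqr_ge0// le_max lexx orbT.
- by apply: integral_ramp; lra.
- apply: le_lt_trans (Loo_norm_le _ _ _ _ : (_ <= (4 * r)%:E)%E) _.
  + by rewrite lee_fin; lra.
  + move=> t t01; rewrite marginal_stair// lee_fin/=.
    rewrite (_ : 1 + _ = 2 * t); last by rewrite /stair_slope/=; ring.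
    by apply: ramp_close; [lra|move: t01; rewrite /= in_itv].
  + by rewrite lte_fin.
- exact: continuous_subspaceT.
- move=> t; rewrite in_itv/= /stair_slope => t01.
  by case: (val j) => [|[|?]]; lra.
- transitivity (\int[@lebesgue_measure R]_(t in `[0%R, 1%R])
    (2 * stair_slope R j * t + (1 - stair_slope R j))%:E)%E.
    by apply: eq_integral => t _; congr EFin; ring.
  by rewrite integral_affine//; congr EFin; field.
(* For the other indices the marginal is kept, so the distance is 0. *)
- apply: le_lt_trans (Loo_norm_le _ _ _ _ : (_ <= 0)%E) _ => //.
  by move=> t t01; rewrite marginal_stair// subee// abse0.
Unshelve. all: by end_near. Qed.
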